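(* Let $f$ be a real-valued univariate function with domain $I:=[0,U)$, where $U\in\{w\in\mathbb{R}: w>0\}\cup\{+\infty\}$. Suppose that $\delta>0$ and $U\ge 2\delta$. Assume that $f(0)=0$ and that $f$ is twice differentiable at $\delta$. Assume further that $f$ is continuous, increasing, and strictly concave on $[0,U)$, and that $f$ is thrice differentiable on $(0,U)$. Moreover, suppose that (I) $f'''$ is decreasing on $(0,2\delta)$; (II) $f'''(w)\ge 0$ for all $w\in(0,2\delta)$. Let $g$ be the $\delta$-smoothing of $f$, with coefficients $g_1,g_2,g_3$. Then $$h(w):=f(w+\hat\lambda)-f(\hat\lambda)\ \le\ g(w)$$ for all $w$ in the domain of $f$ such that $w+\hat\lambda$ is also in the domain of $f$, where the shift constant $\hat\lambda\in(0,U)$ is chosen so that $h'(0)=g_1$, i.e. $\hat\lambda=(f')^{-1}(g_1)$.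
   Context: Given $f$ on $[0,U)$ with $f(0)=0$ and $f$ twice differentiable at $\delta\in(0,U)$, the $\delta$-smoothing of $f$ is the function $g$ on $[0,U)$ defined by $g(w)=g_1w+\frac12 g_2w^2+\frac16 g_3w^3$ for $0\le w\le\delta$ and $g(w)=f(w)$ for $\delta<w<U$, where $$g_1=\frac{3f(\delta)}{\delta}-2f'(\delta)+\frac{\delta f''(\delta)}{2},\quad g_2=-\frac{6f(\delta)}{\delta^2}+\frac{6f'(\delta)}{\delta}-2f''(\delta),\quad g_3=\frac{6f(\delta)}{\delta^3}-\frac{6f'(\delta)}{\delta^2}+\frac{3f''(\delta)}{\delta}.$$ Increasing and decreasing are meant strictly: $\phi$ is increasing (decreasing) if $\phi(w_1)<\phi(w_2)$ (resp. $\phi(w_1)>\phi(w_2)$) for all $w_1<w_2$. Strictly concave means $\phi(\lambda w_1+(1-\lambda)w_2)>\lambda\phi(w_1)+(1-\lambda)\phi(w_2)$ for all $w_1<w_2$ and $0<\lambda<1$. *)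

(* Defs.v *)
From Stdlib Require Import Reals.
From Coquelicot Require Import Coquelicot.
Open Scope R_scope.

(** A function with domain [[0,U)], where [U] is a positive real or [p_infty],
    is represented by a total [f : R -> R] whose values off the domain are
    irrelevant. *)
Definition dom (U : Rbar) (w : R) : Prop := 0 <= w /\ Rbar_lt w U.

Definition open_dom (U : Rbar) (w : R) : Prop := 0 < w /\ Rbar_lt w U.

Definition increasing_on (D : R -> Prop) (phi : R -> R) : Prop :=
  forall w1 w2, D w1 -> D w2 -> w1 < w2 -> phi w1 < phi w2.

Definition decreasing_on (D : R -> Prop) (phi : R -> R) : Prop :=
  forall w1 w2, D w1 -> D w2 -> w1 < w2 -> phi w1 > phi w2.

Definition strictly_concave_on (D : R -> Prop) (phi : R -> R) : Prop :=
  forall w1 w2 t, D w1 -> D w2 -> w1 < w2 -> 0 < t < 1 ->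
    phi (t * w1 + (1 - t) * w2) > t * phi w1 + (1 - t) * phi w2.

(** [ex_derive_n f n x] alone is too weak: it only says that the total function
    [Derive_n f (n-1)], which takes junk values where [f] is not [n-1] times
    differentiable, is differentiable at [x]. *)
Definition n_differentiable_at (n : nat) (f : R -> R) (x : R) : Prop :=
  locally x (fun y => forall k, (k < n)%nat -> ex_derive_n f k y) /\
  ex_derive_n f n x.

Definition coef1 (f : R -> R) (delta : R) : R :=
  3 * f delta / delta - 2 * Derive f delta + delta * Derive_n f 2 delta / 2.

Definition coef2 (f : R -> R) (delta : R) : R :=
  - (6 * f delta / delta ^ 2) + 6 * Derive f delta / delta
  - 2 * Derive_n f 2 delta.

Definition coef3 (f : R -> R) (delta : R) : R :=
  6 * f delta / delta ^ 3 - 6 * Derive f delta / delta ^ 2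
  + 3 * Derive_n f 2 delta / delta.

Definition smoothing (f : R -> R) (delta w : R) : R :=
  if Rle_dec w delta
  then coef1 f delta * w + / 2 * coef2 f delta * w ^ 2
       + / 6 * coef3 f delta * w ^ 3
  else f w.

Definition shift (f : R -> R) (lambda w : R) : R := f (w + lambda) - f lambda.

(** The shift lives on [[0, U - lambda)], where [0] is an endpoint; since
    [lambda] is interior to the domain of [f], the one-sided derivative at [0]
    agrees with the two-sided one used here. *)
Definition is_shift_constant (U : Rbar) (f : R -> R) (delta lambda : R) : Prop :=
  open_dom U lambda /\ Derive (shift f lambda) 0 = coef1 f delta.

(* Main.v *)
Require Import Defs.
From Stdlib Require Import Reals Ranalysis5 Lra Lia.
From Coquelicot Require Import Coquelicot.
Open Scope R_scope.

(** Write [g] for the smoothing cubic on [[0,delta]], with coefficients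
    [g1], [g2], [g3]: it is the cubic that vanishes at [0] and has the value
    and the first two derivatives of [f] at [delta].

    The error [e := f - g] vanishes at [0] and to third order at [delta], while
    [e'''] is decreasing.  Rolle's theorem applied three times gives
    [a < b < c] in [(0,delta)] at which [e'], [e''], [e'''] vanish.  At [c],
    [g3 = f''' c > 0]; with [g'' delta = f'' delta <= 0] this makes [g']
    decreasing, so [g1 = g' 0 > g' delta = f' delta].  As [e''' > 0] before [c], one gets
    [e'' < 0] before [b], so [e'] stays above a positive constant near [0] and
    [f'] exceeds [g1] there ([triple_contact_error]).  The derivative [f'] is
    continuous and, by strict concavity, decreasing
    ([strictly_concave_derivative_decreasing]); hence it takes the value [g1]
    exactly once, at some [lambda < delta].

    For [w > delta], [h w <= g w] says
    [f (w + lambda) <= f w + f lambda], the subadditivity of a concave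
    function that vanishes at [0].  For [w <= delta], put [k := g - h].  Then
    [k 0 = k' 0 = 0] by the choice of [lambda]; moreover
    [k' delta = f' delta - f' (delta + lambda) >= 0] because [f'] decreases,
    [k'' delta = f'' delta - f'' (delta + lambda) <= 0] because [f''' >= 0],
    and [k'''] is increasing.  So [k''] is convex, and being nonpositive at
    [delta] it can change sign only from positive to negative: [k'] rises and
    then falls, between two nonnegative end values, so [k' >= 0]
    ([nonneg_of_convex_derivative]) and [k >= k 0 = 0]. *)

(** * Mean value theorems *)

Lemma mean_value (F dF : R -> R) (a b : R) :
  a < b -> (forall x, a <= x <= b -> is_derive F x (dF x)) ->
  exists c, a < c < b /\ F b - F a = dF c * (b - a).
Proof.
  intros Hab HF.
  destruct (MVT_cor2 F dF a b Hab) as [c [Hc1 Hc2]].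
  - intros c Hc. apply is_derive_Reals, HF, Hc.
  - exists c; split; assumption.
Qed.

(** At the left end point only continuity from the right is available: for a
    function with domain [[0,U)], the values to the left of [0] are arbitrary. *)
Lemma mean_value_right_continuous (F dF : R -> R) (a b : R) :
  a < b -> filterlim F (at_right a) (locally (F a)) ->
  (forall x, a < x <= b -> is_derive F x (dF x)) ->
  exists c, a < c < b /\ F b - F a = dF c * (b - a).
Proof.
  intros Hab Ha HF.
  (* extending [F] by the constant [F a] to the left of [a] makes it
     continuous at [a] *)
  set (G := fun x => F (Rmax a x)).
  assert (HG : forall x, a < x <= b -> is_derive G x (dF x)).
  { intros x Hx. apply is_derive_ext_loc with F; [|now apply HF].
    apply filter_imp with (fun y => a < y).
    - intros y Hy. unfold G. now rewrite Rmax_right by lra.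
    - apply (open_gt a). lra. }
  assert (Ga : continuity_pt G a).
  { apply continuity_pt_filterlim. intros P HP.
    assert (EG : G a = F a) by (unfold G; now rewrite Rmax_left by lra).
    rewrite EG in HP. specialize (Ha P HP).
    unfold filtermap, at_right, within in *.
    apply filter_imp with (2 := Ha). intros y Hy. unfold G.
    destruct (Rlt_le_dec a y) as [H|H].
    - rewrite Rmax_right by lra. now apply Hy.
    - rewrite Rmax_left by lra. now apply locally_singleton. }
  assert (pr : forall c, a < c < b -> derivable_pt G c).
  { intros c Hc. exists (dF c). apply is_derive_Reals, HG. lra. }
  destruct (MVT G id a b pr (fun c _ => derivable_pt_id c) Hab)
    as [c [Hc E]].
  - intros c Hc. destruct (Req_dec c a) as [->|N]; [exact Ga|].
    apply derivable_continuous_pt. exists (dF c).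
    apply is_derive_Reals, HG. lra.
  - intros c _. apply derivable_continuous_pt, derivable_pt_id.
  - exists c; split; [exact Hc|].
    rewrite derive_pt_id in E.
    assert (D : derive_pt G c (pr c Hc) = dF c).
    { apply derive_pt_eq_0, is_derive_Reals, HG. lra. }
    rewrite D in E. unfold G, id in E.
    rewrite Rmax_right, Rmax_left in E by lra. lra.
Qed.

(** * Sign arguments on the first and third derivatives *)

(** A function whose second derivative increases has a convex derivative; if
    that derivative is nonpositive at the right end, the function rises and
    then falls, so it is bounded below by its end values. *)
Lemma nonneg_of_convex_derivative (k dk d2k : R -> R) (a b : R) :
  (forall x, a <= x <= b -> is_derive k x (dk x)) ->
  (forall x, a <= x <= b -> is_derive dk x (d2k x)) ->
  increasing_on (fun x => a < x < b) d2k ->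
  0 <= k a -> 0 <= k b -> dk b <= 0 ->
  forall x, a <= x <= b -> 0 <= k x.
Proof.
  intros Hk Hdk Hinc Ha Hb Hdb x Hx.
  destruct (Rle_lt_dec 0 (k x)) as [H|H]; [exact H|exfalso].
  assert (Nxa : x <> a) by (intros ->; lra).
  assert (Nxb : x <> b) by (intros ->; lra).
  (* a negative value would make [dk] negative, then positive, then
     nonpositive, against its convexity *)
  destruct (mean_value k dk a x) as [p [Hp Ep]];
    [lra | intros; apply Hk; lra |].
  destruct (mean_value k dk x b) as [q [Hq Eq]];
    [lra | intros; apply Hk; lra |].
  assert (dk p < 0) by nra.
  assert (0 < dk q) by nra.
  destruct (mean_value dk d2k p q) as [r [Hr Er]];
    [lra | intros; apply Hdk; lra |].
  destruct (mean_value dk d2k q b) as [s [Hs Es]];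
    [lra | intros; apply Hdk; lra |].
  assert (0 < d2k r) by nra.
  assert (d2k s < 0) by nra.
  assert (d2k r < d2k s) by (apply Hinc; lra).
  lra.
Qed.

(** Repeated Rolle gives zeros [p < q < c] of the three derivatives.  Since
    [d3e] decreases, it is positive before [c]; hence [d2e] is negative before
    [q], and [de] decreases there, to the value [0] at [p]. *)
Lemma triple_contact_error (e de d2e d3e : R -> R) (a b : R) :
  a < b -> filterlim e (at_right a) (locally (e a)) ->
  (forall x, a < x <= b -> is_derive e x (de x)) ->
  (forall x, a < x <= b -> is_derive de x (d2e x)) ->
  (forall x, a < x <= b -> is_derive d2e x (d3e x)) ->
  decreasing_on (fun x => a < x < b) d3e ->
  e a = e b -> de b = 0 -> d2e b = 0 ->
  (exists c, a < c < b /\ d3e c = 0) /\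
  (exists r eta, a < r < b /\ 0 < eta /\ forall x, a < x < r -> eta < de x).
Proof.
  intros Hab Hcont He Hde Hd2e Hdec Hends Hdb Hd2b.
  destruct (mean_value_right_continuous e de a b Hab Hcont He)
    as [p [Hp Ep]].
  assert (Zp : de p = 0) by nra.
  destruct (mean_value de d2e p b) as [q [Hq Eq]];
    [lra | intros; apply Hde; lra |].
  assert (Zq : d2e q = 0) by nra.
  destruct (mean_value d2e d3e q b) as [c [Hc Ec]];
    [lra | intros; apply Hd2e; lra |].
  assert (Zc : d3e c = 0) by nra.
  split; [exists c; split; [lra | exact Zc]|].
  assert (Neg : forall x, a < x < q -> d2e x < 0).
  { intros x Hx.
    destruct (mean_value d2e d3e x q) as [s [Hs Es]];
      [lra | intros; apply Hd2e; lra |].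
    assert (d3e s > d3e c) by (apply Hdec; lra).
    nra. }
  assert (Dec : forall x y, a < x -> x < y -> y < q -> de y < de x).
  { intros x y Hx Hxy Hy.
    destruct (mean_value de d2e x y) as [s [Hs Es]];
      [lra | intros; apply Hde; lra |].
    assert (d2e s < 0) by (apply Neg; lra).
    nra. }
  exists ((a + p) / 2), (de ((a + p) / 2)).
  split; [lra|]. split.
  - rewrite <- Zp. apply Dec; lra.
  - intros x Hx. apply Dec; lra.
Qed.

(** * Domains and concavity *)

Lemma open_dom_convex (U : Rbar) (a b x : R) :
  open_dom U a -> open_dom U b -> a <= x <= b -> open_dom U x.
Proof.
  intros [Ha _] [_ Hb] Hx. split; [lra|].
  apply Rbar_le_lt_trans with b; [simpl; lra | exact Hb].
Qed.

Lemma open_dom_dom (U : Rbar) (x : R) : open_dom U x -> dom U x.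
Proof. intros [H1 H2]; split; [lra | exact H2]. Qed.

Lemma open_dom_locally (U : Rbar) (x : R) :
  open_dom U x -> locally x (open_dom U).
Proof.
  intros [H1 H2].
  apply filter_and; [now apply (open_gt 0)|].
  now apply (open_Rbar_lt U).
Qed.

(** The mean value form of decreasing slopes: between [a] and [b] the derivative
    takes the slope of the left half-chord before that of the right one. *)
Lemma strictly_concave_slopes (D : R -> Prop) (f df : R -> R) (a b : R) :
  D a -> D b -> a < b -> strictly_concave_on D f ->
  (forall x, a <= x <= b -> is_derive f x (df x)) ->
  exists p q, a < p < q /\ q < b /\ df q < df p.
Proof.
  intros Ha Hb Hab Hconc Hf.
  destruct (mean_value f df a ((a + b) / 2)) as [p [Hp Ep]];
    [lra | intros; apply Hf; lra |].
  destruct (mean_value f df ((a + b) / 2) b) as [q [Hq Eq]];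
    [lra | intros; apply Hf; lra |].
  exists p, q. split; [lra|]. split; [lra|].
  assert (C := Hconc a b (/ 2) Ha Hb Hab ltac:(lra)).
  replace (/ 2 * a + (1 - / 2) * b) with ((a + b) / 2) in C by field.
  nra.
Qed.

(** A positive value of the continuous second derivative would make the slopes
    increase nearby. *)
Lemma strictly_concave_second_derivative (U : Rbar) (f df d2f : R -> R) :
  strictly_concave_on (dom U) f ->
  (forall x, open_dom U x -> is_derive f x (df x)) ->
  (forall x, open_dom U x -> is_derive df x (d2f x)) ->
  (forall x, open_dom U x -> continuous d2f x) ->
  forall x, open_dom U x -> d2f x <= 0.
Proof.
  intros Hconc Hf Hdf Hcont x Hx.
  destruct (Rle_lt_dec (d2f x) 0) as [H|H]; [exact H|exfalso].
  assert (L : locally x (fun y => open_dom U y /\ 0 < d2f y)).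
  { apply filter_and; [now apply open_dom_locally|].
    apply (Hcont x Hx (fun z => 0 < z)). now apply (open_gt 0). }
  destruct L as [eps L].
  pose proof (cond_pos eps) as Heps.
  assert (Near : forall y, x <= y <= x + eps / 2 ->
                 open_dom U y /\ 0 < d2f y).
  { intros y Hy. apply L. apply Rabs_lt_between'. lra. }
  destruct (strictly_concave_slopes (dom U) f df x (x + eps / 2))
    as [p [q [Hp [Hq Hpq]]]].
  - now apply open_dom_dom.
  - apply open_dom_dom, Near. lra.
  - lra.
  - exact Hconc.
  - intros y Hy. apply Hf, Near, Hy.
  - destruct (mean_value df d2f p q) as [s [Hs Es]].
    + lra.
    + intros y Hy. apply Hdf, Near. lra.
    + assert (0 < d2f s) by (apply Near; lra). nra.
Qed.

Lemma strictly_concave_derivative_decreasing (U : Rbar) (f df d2f : R -> R) :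
  strictly_concave_on (dom U) f ->
  (forall x, open_dom U x -> is_derive f x (df x)) ->
  (forall x, open_dom U x -> is_derive df x (d2f x)) ->
  (forall x, open_dom U x -> continuous d2f x) ->
  decreasing_on (open_dom U) df.
Proof.
  intros Hconc Hf Hdf Hcont.
  assert (Mono : forall x y, open_dom U x -> open_dom U y -> x < y ->
                 df y <= df x).
  { intros x y Hx Hy Hxy.
    destruct (mean_value df d2f x y Hxy) as [s [Hs Es]].
    - intros z Hz. apply Hdf. now apply open_dom_convex with x y.
    - assert (d2f s <= 0).
      { apply (strictly_concave_second_derivative U f df d2f); auto.
        apply open_dom_convex with x y; auto; lra. }
      nra. }
  intros a b Ha Hb Hab.
  destruct (strictly_concave_slopes (dom U) f df a b)
    as [p [q [Hp [Hq Hpq]]]]; auto using open_dom_dom.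
  - intros z Hz. apply Hf. now apply open_dom_convex with a b.
  - assert (df p <= df a)
      by (apply Mono; try lra; auto; apply open_dom_convex with a b; auto; lra).
    assert (df b <= df q)
      by (apply Mono; try lra; auto; apply open_dom_convex with a b; auto; lra).
    lra.
Qed.

(** At [x] and at [y] the graph is above the chord from [(0, 0)] to
    [(x + y, f (x + y))], whose heights there add up to [f (x + y)]. *)
Lemma strictly_concave_subadditive (D : R -> Prop) (f : R -> R) (x y : R) :
  strictly_concave_on D f -> f 0 = 0 -> D 0 -> D (x + y) ->
  0 < x -> 0 < y -> f (x + y) < f x + f y.
Proof.
  intros Hconc H0 D0 Dxy Hx Hy.
  assert (C : forall u v, 0 < u -> 0 < v -> u + v = x + y ->
              u / (x + y) * f (x + y) < f u).
  { intros u v Hu Hv E.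
    assert (T : 0 < v / (x + y) < 1).
    { split; [apply Rdiv_lt_0_compat; lra|].
      apply Rlt_div_l; lra. }
    assert (C := Hconc 0 (x + y) (v / (x + y)) D0 Dxy ltac:(lra) T).
    replace (1 - v / (x + y)) with (u / (x + y)) in C
      by (rewrite <- E; field; lra).
    rewrite H0 in C.
    replace (v / (x + y) * 0 + u / (x + y) * (x + y)) with u in C
      by (field; lra).
    lra. }
  assert (Cx := C x y Hx Hy eq_refl).
  assert (Cy := C y x Hy Hx ltac:(lra)).
  assert (E : x / (x + y) * f (x + y) + y / (x + y) * f (x + y) = f (x + y))
    by (field; lra).
  lra.
Qed.

(** * The smoothing cubic *)

Lemma smoothing_cubic_contact (f : R -> R) (delta : R) :
  delta <> 0 ->
  f delta = coef1 f delta * delta + / 2 * coef2 f delta * delta ^ 2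
            + / 6 * coef3 f delta * delta ^ 3 /\
  Derive f delta = coef1 f delta + coef2 f delta * delta
                   + / 2 * coef3 f delta * delta ^ 2 /\
  Derive_n f 2 delta = coef2 f delta + coef3 f delta * delta.
Proof.
  intros Hd. unfold coef1, coef2, coef3.
  repeat split; field; exact Hd.
Qed.

Lemma is_derive_sub (F G : R -> R) (x dF dG : R) :
  is_derive F x dF -> is_derive G x dG ->
  is_derive (fun y => F y - G y) x (dF - dG).
Proof. intros HF HG. exact (is_derive_minus F G x dF dG HF HG). Qed.

Lemma is_derive_translate (F : R -> R) (x dF lambda : R) :
  is_derive F (x + lambda) dF -> is_derive (fun y => F (y + lambda)) x dF.
Proof.
  intros HF. replace dF with (scal 1 dF) by apply Rmult_1_l.
  apply (is_derive_comp F (fun y => y + lambda) x dF 1); [exact HF|].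
  auto_derive; [exact I | ring].
Qed.

Lemma is_derive_cubic (g1 g2 g3 x : R) :
  is_derive (fun y => g1 * y + / 2 * g2 * y ^ 2 + / 6 * g3 * y ^ 3) x
    (g1 + g2 * x + / 2 * g3 * x ^ 2).
Proof. auto_derive; [exact I | field]. Qed.

Lemma is_derive_quadratic (g1 g2 g3 x : R) :
  is_derive (fun y => g1 + g2 * y + / 2 * g3 * y ^ 2) x (g2 + g3 * x).
Proof. auto_derive; [exact I | field]. Qed.

Lemma is_derive_affine (g2 g3 x : R) :
  is_derive (fun y => g2 + g3 * y) x g3.
Proof. auto_derive; [exact I | ring]. Qed.

(** This is what puts the shift constant in [(0, delta)], by the intermediate
    value theorem for [df].  The lower bound holds because the slope of the
    cubic decreases from [g1] to [df delta]; the upper one because near [0] the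
    slope of the cubic is close to [g1], while [df] exceeds it by a gap bounded
    away from [0]. *)
Lemma smoothing_slope_between (f df d2f d3f : R -> R) (g1 g2 g3 delta : R) :
  0 < delta -> f 0 = 0 ->
  filterlim f (at_right 0) (locally (f 0)) ->
  (forall x, 0 < x <= delta -> is_derive f x (df x)) ->
  (forall x, 0 < x <= delta -> is_derive df x (d2f x)) ->
  (forall x, 0 < x <= delta -> is_derive d2f x (d3f x)) ->
  decreasing_on (fun x => 0 < x < delta) d3f ->
  (forall x, 0 < x < delta -> 0 <= d3f x) ->
  f delta = g1 * delta + / 2 * g2 * delta ^ 2 + / 6 * g3 * delta ^ 3 ->
  df delta = g1 + g2 * delta + / 2 * g3 * delta ^ 2 ->
  d2f delta = g2 + g3 * delta ->
  d2f delta <= 0 ->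
  df delta < g1 /\ exists x, 0 < x < delta /\ g1 < df x.
Proof.
  intros Hd H0 Hcont Hf Hdf Hd2f Hdec Hpos E0 E1 E2 Hneg.
  set (g := fun y => g1 * y + / 2 * g2 * y ^ 2 + / 6 * g3 * y ^ 3).
  assert (Dg : forall x, is_derive g x (g1 + g2 * x + / 2 * g3 * x ^ 2))
    by (intros x; apply is_derive_cubic).
  destruct (triple_contact_error
    (fun y => f y - g y)
    (fun y => df y - (g1 + g2 * y + / 2 * g3 * y ^ 2))
    (fun y => d2f y - (g2 + g3 * y))
    (fun y => d3f y - g3) 0 delta)
    as [[c [Hc Zc]] [r [eta [Hr [Heta Hnear]]]]].
  - exact Hd.
  - apply (filterlim_comp_2 (F := at_right 0) (G := locally (f 0))
             (H := locally (- g 0)) f (fun y => - g y) Rplus).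
    + exact Hcont.
    + apply (filterlim_filter_le_1 (F := locally 0) (G := at_right 0)
               (fun y => - g y)); [apply filter_le_within|].
      apply (continuous_opp (V := R_NormedModule) g 0).
      apply (ex_derive_continuous (K := R_AbsRing) (V := R_NormedModule)).
      eexists; apply Dg.
    + exact (filterlim_plus (V := R_NormedModule) (f 0) (- g 0)).
  - intros x Hx. apply is_derive_sub; [now apply Hf | apply Dg].
  - intros x Hx. apply is_derive_sub; [now apply Hdf | apply is_derive_quadratic].
  - intros x Hx. apply is_derive_sub; [now apply Hd2f | apply is_derive_affine].
  - intros x y Hx Hy Hxy. assert (d3f x > d3f y) by now apply Hdec. lra.
  - unfold g. rewrite H0, E0. ring.
  - rewrite E1. ring.
  - rewrite E2. ring.
  - cbv beta in Zc, Hnear.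
    assert (G3 : 0 < g3).
    { assert (d3f c > d3f ((c + delta) / 2)) by (apply Hdec; lra).
      assert (0 <= d3f ((c + delta) / 2)) by (apply Hpos; lra).
      lra. }
    split.
    { replace (df delta)
        with (g1 + d2f delta * delta - / 2 * (g3 * (delta * delta)))
        by (rewrite E1, E2; field).
      assert (0 < delta * delta) by nra.
      assert (0 < g3 * (delta * delta)) by now apply Rmult_lt_0_compat.
      nra. }
    (* a point so close to [0] that [g'] has dropped from [g1] by less than
       the gap [eta] *)
    set (B := Rabs g2 + 1).
    assert (HB : 0 < B) by (unfold B; pose proof (Rabs_pos g2); lra).
    set (x := Rmin (r / 2) (eta / B)).
    assert (Hq : 0 < eta / B) by now apply Rdiv_lt_0_compat.
    assert (Hx0 : 0 < x) by (apply Rmin_glb_lt; lra).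
    assert (Hx1 : x <= r / 2) by apply Rmin_l.
    assert (Hx2 : x * B <= eta).
    { apply Rle_div_r; [exact HB | apply Rmin_r]. }
    exists x. split; [lra|].
    assert (Hnx := Hnear x ltac:(lra)).
    assert (Habs : - g2 <= Rabs g2)
      by (rewrite <- Rabs_Ropp; apply Rle_abs).
    assert (- g2 * x <= eta) by (unfold B in Hx2; nra).
    assert (0 <= g3 * x ^ 2) by nra.
    lra.
Qed.

(** The case [w <= delta] of the bound: [df lambda = g1] is the condition that
    both sides have the same slope at [0]. *)
Lemma shift_le_smoothing_cubic
  (f df d2f d3f : R -> R) (g1 g2 g3 delta lambda : R) :
  0 < lambda < delta ->
  (forall x, 0 < x < 2 * delta -> is_derive f x (df x)) ->
  (forall x, 0 < x < 2 * delta -> is_derive df x (d2f x)) ->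
  (forall x, 0 < x < 2 * delta -> is_derive d2f x (d3f x)) ->
  decreasing_on (fun x => 0 < x < 2 * delta) d3f ->
  (forall x, 0 < x < 2 * delta -> 0 <= d3f x) ->
  df (delta + lambda) <= df delta ->
  df delta = g1 + g2 * delta + / 2 * g3 * delta ^ 2 ->
  d2f delta = g2 + g3 * delta ->
  df lambda = g1 ->
  forall w, 0 <= w <= delta ->
  shift f lambda w <= g1 * w + / 2 * g2 * w ^ 2 + / 6 * g3 * w ^ 3.
Proof.
  intros Hl Hf Hdf Hd2f Hdec Hpos Hmono E1 E2 El w Hw.
  set (k := fun y => (g1 * y + / 2 * g2 * y ^ 2 + / 6 * g3 * y ^ 3)
                     - f (y + lambda)).
  set (dk := fun y => (g1 + g2 * y + / 2 * g3 * y ^ 2) - df (y + lambda)).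
  assert (Dk : forall x, 0 <= x <= delta -> is_derive k x (dk x)).
  { intros x Hx. apply is_derive_sub; [apply is_derive_cubic|].
    apply is_derive_translate, Hf. lra. }
  assert (Hdk : forall x, 0 <= x <= delta -> 0 <= dk x).
  { apply (nonneg_of_convex_derivative dk
      (fun y => (g2 + g3 * y) - d2f (y + lambda))
      (fun y => g3 - d3f (y + lambda))).
    - intros x Hx. apply is_derive_sub; [apply is_derive_quadratic|].
      apply is_derive_translate, Hdf. lra.
    - intros x Hx. apply is_derive_sub; [apply is_derive_affine|].
      apply is_derive_translate, Hd2f. lra.
    - intros x y Hx Hy Hxy.
      assert (d3f (x + lambda) > d3f (y + lambda)) by (apply Hdec; lra).
      lra.
    - unfold dk. rewrite Rplus_0_l, El. lra.
    - unfold dk. lra.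
    - rewrite <- E2.
      destruct (mean_value d2f d3f delta (delta + lambda)) as [s [Hs Es]];
        [lra | intros; apply Hd2f; lra |].
      assert (0 <= d3f s) by (apply Hpos; lra).
      nra. }
  assert (Hk : k 0 <= k w).
  { destruct (Req_dec w 0) as [->|N]; [lra|].
    destruct (mean_value k dk 0 w) as [s [Hs Es]];
      [lra | intros; apply Dk; lra |].
    assert (0 <= dk s) by (apply Hdk; lra).
    nra. }
  unfold k in Hk. rewrite Rplus_0_l in Hk. unfold shift. lra.
Qed.

(** * The shifted function stays below the smoothing *)

Lemma n_differentiable_at_is_derive (n k : nat) (f : R -> R) (x : R) :
  n_differentiable_at n f x -> (k < n)%nat ->
  is_derive (Derive_n f k) x (Derive_n f (S k) x).
Proof.
  intros [Hloc Hn] Hk. apply Derive_correct.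
  destruct (Nat.eq_dec (S k) n) as [<-|N]; [exact Hn|].
  apply (locally_singleton _ _ Hloc (S k)). lia.
Qed.

Theorem theorem4p1 (U : Rbar) (f : R -> R) (delta : R)
  (hU : Rbar_lt 0 U)
  (hdelta : 0 < delta)
  (hUdelta : Rbar_le (2 * delta) U)
  (hf0 : f 0 = 0)
  (hf2 : n_differentiable_at 2 f delta)
  (hcont : continuous_on (dom U) f)
  (hincr : increasing_on (dom U) f)
  (hconc : strictly_concave_on (dom U) f)
  (hf3 : forall w : R, open_dom U w -> n_differentiable_at 3 f w)
  (hI : decreasing_on (fun w => 0 < w < 2 * delta) (Derive_n f 3))
  (hII : forall w : R, 0 < w < 2 * delta -> Derive_n f 3 w >= 0) :
  (exists! lambda : R, is_shift_constant U f delta lambda) /\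
  (forall lambda : R, is_shift_constant U f delta lambda ->
   forall w : R, dom U w -> dom U (w + lambda) ->
     shift f lambda w <= smoothing f delta w).
Proof.
  assert (In : forall x, 0 < x < 2 * delta -> open_dom U x).
  { intros x Hx. split; [lra|].
    apply Rbar_lt_le_trans with (2 * delta); [simpl; lra | exact hUdelta]. }
  assert (D1 : forall x, open_dom U x -> is_derive f x (Derive f x)).
  { intros x Hx.
    apply (n_differentiable_at_is_derive 3 0 f x); [now apply hf3 | lia]. }
  assert (D2 : forall x, open_dom U x ->
               is_derive (Derive f) x (Derive_n f 2 x)).
  { intros x Hx.
    apply (n_differentiable_at_is_derive 3 1 f x); [now apply hf3 | lia]. }
  assert (D3 : forall x, open_dom U x ->
               is_derive (Derive_n f 2) x (Derive_n f 3 x)).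
  { intros x Hx.
    apply (n_differentiable_at_is_derive 3 2 f x); [now apply hf3 | lia]. }
  assert (C2 : forall x, open_dom U x -> continuous (Derive_n f 2) x).
  { intros x Hx. apply (ex_derive_continuous (Derive_n f 2)).
    eexists; apply D3, Hx. }
  assert (Ddelta : open_dom U delta) by (apply In; lra).
  assert (Dec := strictly_concave_derivative_decreasing
                   U f (Derive f) (Derive_n f 2) hconc D1 D2 C2).
  assert (Neg := strictly_concave_second_derivative
                   U f (Derive f) (Derive_n f 2) hconc D1 D2 C2 delta Ddelta).
  destruct (smoothing_cubic_contact f delta ltac:(lra)) as [E0 [E1 E2]].
  assert (D0 : dom U 0) by (split; [lra | exact hU]).
  assert (Cont0 : filterlim f (at_right 0) (locally (f 0))).
  { intros P HP. specialize (hcont 0 D0 P HP).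
    unfold filtermap, at_right, within in *.
    assert (L : locally 0 (fun y => y < delta)) by now apply (open_lt delta).
    apply filter_imp with (2 := filter_and _ _ hcont L).
    intros y [Hy Hyd] H0y. apply Hy, open_dom_dom, In. lra. }
  destruct (smoothing_slope_between f (Derive f) (Derive_n f 2) (Derive_n f 3)
    (coef1 f delta) (coef2 f delta) (coef3 f delta) delta)
    as [Slope [x0 [Hx0 Slope0]]];
    [exact hdelta | exact hf0 | exact Cont0 | | | | | | exact E0 | exact E1
    | exact E2 | exact Neg |].
  1: intros x Hx; apply D1, In; lra.
  1: intros x Hx; apply D2, In; lra.
  1: intros x Hx; apply D3, In; lra.
  1: intros x y Hx Hy Hxy; apply hI; lra.
  1: intros x Hx; apply Rge_le, hII; lra.
  assert (Shift : forall lambda, is_shift_constant U f delta lambda <->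
            open_dom U lambda /\ Derive f lambda = coef1 f delta).
  { intros lambda. unfold is_shift_constant.
    assert (E : open_dom U lambda ->
                Derive (shift f lambda) 0 = Derive f lambda).
    { intros Hl. apply is_derive_unique.
      replace (Derive f lambda) with (Derive f lambda - 0) by ring.
      apply (is_derive_sub (fun y => f (y + lambda)) (fun _ => f lambda)).
      - apply is_derive_translate. rewrite Rplus_0_l. now apply D1.
      - apply (is_derive_const (f lambda) 0). }
    split; intros [Hl H]; (split; [exact Hl|]); rewrite <- H;
      [symmetry|]; exact (E Hl). }
  split.
  - destruct (IVT_interv (fun t => coef1 f delta - Derive f t) x0 delta)
      as [lambda [Hl El]].
    + intros t Ht. apply derivable_continuous_pt.
      exists (0 - Derive_n f 2 t). apply is_derive_Reals.
      apply is_derive_sub; [apply (is_derive_const (coef1 f delta) t)|].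
      apply D2, In. lra.
    + lra.
    + lra.
    + lra.
    + exists lambda. split.
      * apply Shift. split; [apply In; lra | lra].
      * intros mu Hmu. apply Shift in Hmu. destruct Hmu as [Hmu Emu].
        assert (Dl : open_dom U lambda) by (apply In; lra).
        destruct (Rtotal_order lambda mu) as [H|[H|H]]; [|exact H|].
        -- assert (Derive f lambda > Derive f mu) by now apply Dec. lra.
        -- assert (Derive f mu > Derive f lambda) by now apply Dec. lra.
  - intros lambda Hl w Hw Hwl. apply Shift in Hl. destruct Hl as [Hl El].
    assert (Hl0 : 0 < lambda) by apply Hl.
    assert (Hld : lambda < delta).
    { destruct (Rtotal_order lambda delta) as [H|[H|H]]; [exact H| |].
      - rewrite H in El. lra.
      - assert (Derive f delta > Derive f lambda) by now apply Dec. lra. }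
    unfold smoothing. destruct (Rle_dec w delta) as [Hwd|Hwd].
    + apply (shift_le_smoothing_cubic f (Derive f) (Derive_n f 2)
               (Derive_n f 3) (coef1 f delta) (coef2 f delta)
               (coef3 f delta) delta lambda);
        [lra | | | | exact hI | | | exact E1 | exact E2 | exact El |].
      * intros x Hx. apply D1, In, Hx.
      * intros x Hx. apply D2, In, Hx.
      * intros x Hx. apply D3, In, Hx.
      * intros x Hx. apply Rge_le, hII, Hx.
      * apply Rlt_le, Dec; [exact Ddelta | apply In; lra | lra].
      * destruct Hw; lra.
    + unfold shift.
      assert (f (w + lambda) < f w + f lambda)
        by (apply (strictly_concave_subadditive (dom U));
            [exact hconc | exact hf0 | exact D0 | exact Hwl | lra | lra]).
      lra.
Qed.
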